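(* Let $\{g_\alpha\}_{\alpha\in(0,\alpha_0)}$ be a spectral regularization method such that for every fixed $\lambda>0$, $g_\alpha(\lambda)$ is decreasing in $\alpha$ for $\alpha\in(0,\alpha_0)$. (a) If there exist an increasing function $h:(0,\alpha_0)\to\mathbb{R}^+$ with $\lim_{\alpha\to0^+}h(\alpha)=0$, a function $\rho^\ast\in\mathcal{O}$ and $\varepsilon>0$ such that for every $\alpha\in(0,\varepsilon)$ $$\sup_{\lambda\in[h(\alpha),+\infty)}|r_\alpha(\lambda)|\le\rho^\ast(\alpha),$$ then $\{g_\alpha\}$ has weak qualification, and in that case $\rho^\ast$ is weak qualification of $\{g_\alpha\}$. (b) If for every $\alpha\in(0,\alpha_0)$, $r_\alpha(\lambda)$ is positive and monotone decreasing for $\lambda\in(0,+\infty)$, then there exist an increasing function $h:(0,\alpha_0)\to\mathbb{R}^+$ with $\lim_{\alpha\to0^+}h(\alpha)=0$ and a function $\rho^\ast\in\mathcal{O}$ such that $\sup_{\lambda\in[h(\alpha),+\infty)}|r_\alpha(\lambda)|\le\rho^\ast(\alpha)$ for all $\alpha\in(0,\alpha_0)$.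
   Context: Let $\alpha_0\in(0,+\infty]$. A spectral regularization method (SRM) is a family $\{g_\alpha\}_{\alpha\in(0,\alpha_0)}$ of functions $g_\alpha:[0,+\infty)\to\mathbb{R}$ such that: for each $\alpha$, $g_\alpha(\lambda)$ is piecewise continuous in $\lambda\in[0,+\infty)$; there is a constant $C>0$, independent of $\alpha$, with $|\lambda g_\alpha(\lambda)|\le C$ for every $\lambda\in[0,+\infty)$; and $\lim_{\alpha\to0^+}g_\alpha(\lambda)=1/\lambda$ for every $\lambda\in(0,+\infty)$. Put $r_\alpha(\lambda)=1-\lambda g_\alpha(\lambda)$. $\mathcal{O}$ is the set of all non-decreasing functions $\rho:\mathbb{R}^+\to\mathbb{R}^+$ with $\lim_{\alpha\to0^+}\rho(\alpha)=0$. $\mathcal{S}$ is the set of all continuous $s:[0,+\infty)\to[0,+\infty)$ with $s(0)=0$ and $s(\lambda)>0$ for every $\lambda>0$. For $s\in\mathcal{S}$, $\rho\in\mathcal{O}$, $(s,\rho)$ is a weak source-order pair for $\{g_\alpha\}$ if for every $\lambda>0$, $\frac{s(\lambda)|r_\alpha(\lambda)|}{\rho(\alpha)}=O(1)$ as $\alpha\to0^+$. A function $\rho\in\mathcal{O}$ is weak qualification of $\{g_\alpha\}$ if there exists $s\in\mathcal{S}$ such that $(s,\rho)$ is a weak source-order pair for $\{g_\alpha\}$. *)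

(* Defs.v *)
From HB Require Import structures.
From mathcomp Require Import all_boot all_order all_algebra.
From mathcomp Require Import all_classical all_reals all_analysis.

Set Implicit Arguments.
Unset Strict Implicit.
Unset Printing Implicit Defensive.

Import Order.TTheory GRing.Theory Num.Theory.
Import numFieldNormedType.Exports.

Local Open Scope classical_set_scope.
Local Open Scope ring_scope.

(* Functions on [0, +oo), (0, +oo) or (0, alpha0) are represented by total
   functions on R; only their values on the intended domain are constrained.
   R^+ denotes (0, +oo), and alpha0 may be +oo. *)

Definition parameter_range (R : realType) (alpha0 : \bar R) : set R :=
  [set a : R | 0 < a /\ (a%:E < alpha0)%E].

(* Finitely many discontinuities in each bounded interval, and finite
   one-sided limits everywhere.  The endpoint 0 may be a discontinuity. *)
Definition piecewise_continuous (R : realType) (f : R -> R) : Prop :=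
  [/\ forall b : R,
        finite_set [set x : R | 0 < x <= b /\ ~ {for x, continuous f}],
      forall x : R, 0 <= x -> cvg (f y @[y --> x^'+]) &
      forall x : R, 0 < x -> cvg (f y @[y --> x^'-])].

(* The value [g a l] stands for g_a(l). *)
Record spectral_regularization (R : realType) (alpha0 : \bar R)
    (g : R -> R -> R) : Prop := SpectralRegularization {
  srm_piecewise_continuous :
    forall a : R, parameter_range alpha0 a -> piecewise_continuous (g a);
  srm_bounded :
    exists2 C : R, 0 < C &
      forall a l : R, parameter_range alpha0 a -> 0 <= l -> `|l * g a l| <= C;
  srm_limit :
    forall l : R, 0 < l -> g a l @[a --> 0^'+] --> l^-1
}.

Definition residual (R : realType) (g : R -> R -> R) (a l : R) : R :=
  1 - l * g a l.

Definition order_function (R : realType) (rho : R -> R) : Prop :=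
  [/\ forall a : R, 0 < a -> 0 < rho a,
      forall a b : R, 0 < a -> a <= b -> rho a <= rho b &
      rho a @[a --> 0^'+] --> 0].

Definition source_function (R : realType) (s : R -> R) : Prop :=
  [/\ {within `[0, +oo[, continuous s},
      forall l : R, 0 <= l -> 0 <= s l,
      s 0 = 0 &
      forall l : R, 0 < l -> 0 < s l].

Definition weak_source_order_pair (R : realType) (g : R -> R -> R)
    (s rho : R -> R) : Prop :=
  forall l : R, 0 < l ->
    (fun a : R => s l * `|residual g a l| / rho a) =O_ (0^'+) (cst (1 : R)).

Definition weak_qualification (R : realType) (g : R -> R -> R)
    (rho : R -> R) : Prop :=
  order_function rho /\
  exists2 s : R -> R, source_function s & weak_source_order_pair g s rho.

Definition has_weak_qualification (R : realType) (g : R -> R -> R) : Prop :=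
  exists rho : R -> R, weak_qualification g rho.

(* Increasing functions h : (0, alpha0) -> R^+ with limit 0 at 0^+;
   "increasing" is strict, as opposed to the "non-decreasing" of
   [order_function]. *)
Definition increasing_null (R : realType) (alpha0 : \bar R)
    (h : R -> R) : Prop :=
  [/\ forall a : R, parameter_range alpha0 a -> 0 < h a,
      forall a b : R, parameter_range alpha0 a -> parameter_range alpha0 b ->
        a < b -> h a < h b &
      h a @[a --> 0^'+] --> 0].

Definition residual_sup (R : realType) (g : R -> R -> R) (a c : R) : \bar R :=
  ereal_sup [set (`|residual g a l|)%:E | l in `[c, +oo[].

(* Main.v *)
Require Import Defs.
From HB Require Import structures.
From mathcomp Require Import all_boot all_order all_algebra.
From mathcomp Require Import all_classical all_reals all_analysis.

Import Order.TTheory GRing.Theory Num.Theory.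
Import numFieldNormedType.Exports.

Local Open Scope classical_set_scope.
Local Open Scope ring_scope.

(** (a) For fixed [l > 0] we have [h a <= l] for all small [a], hence
    [|r_a(l)| <= rho a]; so [s l = l] serves as source function.

    (b) Let [phi a] be the infimum of the [l > 0] such that [r_b(l) <= l] for
    all admissible [b <= a].  It is non-decreasing in [a], and it tends to [0]
    because [r_b(l)] does for each fixed [l].  Since [r_a] decreases, its values
    on [[a + phi a, +oo[] are at most [a + phi a], so [a + phi a] can be taken
    both as [h] and as [rho]. *)

Lemma near_parameter_range (R : realType) (alpha0 : \bar R) :
  (0 < alpha0)%E -> \forall a \near (0 : R)^'+, parameter_range alpha0 a.
Proof.
case: alpha0 => [r| |] //; rewrite ?lte_fin => r_gt0; near=> a; split=> //=.
- by rewrite lte_fin; near: a; exact: nbhs_right_lt.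
- exact: ltry.
Unshelve. all: by end_near. Qed.

Lemma source_function_id (R : realType) : source_function (@id R).
Proof. by split=> //; apply: continuous_subspaceT => x; exact: cvg_id. Qed.

Lemma weak_qualification_of_residual_sup (R : realType) (alpha0 : \bar R)
    (g : R -> R -> R) (h rho : R -> R) (eps : R) :
  (0 < alpha0)%E -> h a @[a --> 0^'+] --> 0 -> order_function rho -> 0 < eps ->
  (forall a : R, parameter_range alpha0 a -> a < eps ->
     (residual_sup g a (h a) <= (rho a)%:E)%E) ->
  weak_qualification g rho.
Proof.
move=> alpha0_gt0 h_to0 rho_order eps_gt0 sup_le; split=> //.
exists id; first exact: source_function_id.
(* Once [|r_a(l)| <= rho a], the quotient [l * |r_a(l)| / rho a] is at most [l], so [l] itself is
   the constant in the O-bound. *)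
move=> l l_gt0; apply/eqO_exP; exists l => //.
near=> a.
have a_range : parameter_range alpha0 a.
  by near: a; exact: near_parameter_range.
have rho_gt0 : 0 < rho a by case: rho_order => + _ _; apply; case: a_range.
have h_le : h a <= l.
  by near: a; apply: (cvgr_le (0 : R) h_to0).
have a_eps : a < eps by near: a; exact: nbhs_right_lt.
have res_le : `|residual g a l| <= rho a.
  rewrite -lee_fin; apply: le_trans (sup_le a a_range a_eps).
  by apply: ereal_sup_ubound; exists l => //=; rewrite in_itv /= h_le.
rewrite /= normr1 mulr1 ger0_norm; last first.
  by rewrite divr_ge0 ?mulr_ge0// ltW.
by rewrite ler_pdivrMr// ler_pM2l.
Unshelve. all: by end_near. Qed.

Lemma residual_cvg0 (R : realType) (alpha0 : \bar R) (g : R -> R -> R) (l : R) :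
  spectral_regularization alpha0 g -> 0 < l ->
  residual g a l @[a --> 0^'+] --> 0.
Proof.
move=> hg l_gt0.
rewrite -[X in _ --> X](subrr (1 : R)) -[X in _ --> _ - X](divff (lt0r_neq0 l_gt0)).
apply: cvgB; first exact: cvg_cst.
by apply: cvgMr; exact: srm_limit hg l l_gt0.
Qed.

Section Threshold.
Variables (R : realType) (alpha0 : \bar R) (g : R -> R -> R).

(** Ranging over all [b <= a], rather than [b = a] alone, makes the set shrink as [a] grows; this is
    what makes its infimum non-decreasing. *)
Definition threshold_set (a : R) : set R :=
  [set l | 0 < l /\ forall b, parameter_range alpha0 b -> b <= a ->
             residual g b l <= l].

(** The summand [a] gives positivity and strict growth, and leaves room above an infimum that may
    not be attained. *)
Definition threshold (a : R) : R := a + inf (threshold_set a).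

Hypotheses (alpha0_gt0 : (0 < alpha0)%E) (hg : spectral_regularization alpha0 g).

Lemma has_inf_threshold_set a : has_inf (threshold_set a).
Proof.
split; last by exists 0 => l [/ltW].
have [C C_gt0 gC] := srm_bounded hg.
have C1_gt0 : 0 < 1 + C by rewrite addr_gt0.
(* Since [|l * g b l| <= C], every residual is at most [1 + C], in particular the one at
   [l = 1 + C]. *)
exists (1 + C); split=> // b b_range _.
have := gC b (1 + C) b_range (ltW C1_gt0).
by rewrite /residual ler_norml => /andP[gC_ge _]; rewrite lerD2l lerNl.
Qed.

Lemma inf_threshold_set_ge0 a : 0 <= inf (threshold_set a).
Proof.
by apply: lb_le_inf; [case: (has_inf_threshold_set a)|move=> l [/ltW]].
Qed.

Lemma le_inf_threshold_set a b :
  a <= b -> inf (threshold_set a) <= inf (threshold_set b).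
Proof.
move=> ab; apply: lb_le_inf; first by case: (has_inf_threshold_set b).
move=> l [l_gt0 res_le]; apply: ge_inf.
  by case: (has_inf_threshold_set a).
by split=> // c c_range ca; apply: res_le => //; exact: le_trans ab.
Qed.

Lemma threshold_gt0 a : 0 < a -> 0 < threshold a.
Proof. by move=> a_gt0; rewrite ltr_wpDr// inf_threshold_set_ge0. Qed.

Lemma lt_threshold a b : a < b -> threshold a < threshold b.
Proof. by move=> ab; rewrite ltr_leD// le_inf_threshold_set// ltW. Qed.

Lemma threshold_cvg0 : threshold a @[a --> 0^'+] --> 0.
Proof.
rewrite -[X in _ --> X](addr0 (0 : R)); apply: cvgD.
  exact/cvg_at_right_filter/cvg_id.
apply/cvgr0Pnorm_le => e e_gt0.
(* For [a < d], all admissible [b <= a] also lie below [d], so [e] belongs to [threshold_set a] and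
   bounds its infimum. *)
have [d /= d_gt0 res_le] : \forall b \near (0 : R)^'+, residual g b e <= e.
  exact: (cvgr_le (0 : R) (residual_cvg0 _ _ _ _ hg e_gt0)).
near=> a.
rewrite ger0_norm ?inf_threshold_set_ge0//; apply: ge_inf.
  by case: (has_inf_threshold_set a).
split=> // b [b_gt0 _] ba; apply: res_le => //=.
rewrite sub0r normrN gtr0_norm//; apply: le_lt_trans ba _.
by near: a; exact: nbhs_right_lt.
Unshelve. all: by end_near. Qed.

Lemma residual_sup_threshold a :
  parameter_range alpha0 a ->
  (forall l, 0 < l -> 0 < residual g a l) ->
  (forall l m, 0 < l -> l <= m -> residual g a m <= residual g a l) ->
  (residual_sup g a (threshold a) <= (threshold a)%:E)%E.
Proof.
move=> a_range res_gt0 res_decr; have [a_gt0 _] := a_range.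
(* The slack [a] yields a member [l] of the set strictly below [threshold a]; the bound
   [r_a(l) <= l] then passes to every [m >= threshold a] by monotonicity. *)
have [l [l_gt0 res_le] l_lt] := inf_adherent a_gt0 (has_inf_threshold_set a).
have {}l_lt : l < threshold a by rewrite /threshold addrC.
apply: ge_ereal_sup => _ [m /= + <-]; rewrite in_itv /= andbT => m_ge.
have lm : l <= m by exact: le_trans (ltW l_lt) m_ge.
rewrite lee_fin gtr0_norm; last by apply: res_gt0; exact: lt_le_trans lm.
apply: le_trans (res_decr _ _ l_gt0 lm) _.
exact: le_trans (res_le a a_range (lexx a)) (ltW l_lt).
Qed.

End Threshold.

Theorem theorem2p1 (R : realType) (alpha0 : \bar R) (halpha0 : (0 < alpha0)%E)
    (g : R -> R -> R) (hg : spectral_regularization alpha0 g)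
    (hdecr : forall l : R, 0 < l ->
       forall a b : R, parameter_range alpha0 a -> parameter_range alpha0 b ->
         a <= b -> g b l <= g a l) :
  (forall (h rho : R -> R) (eps : R),
     increasing_null alpha0 h -> order_function rho -> 0 < eps ->
     (forall a : R, parameter_range alpha0 a -> a < eps ->
        (residual_sup g a (h a) <= (rho a)%:E)%E) ->
     has_weak_qualification g /\ weak_qualification g rho)
  /\
  ((forall a : R, parameter_range alpha0 a ->
      (forall l : R, 0 < l -> 0 < residual g a l) /\
      (forall l m : R, 0 < l -> l <= m -> residual g a m <= residual g a l)) ->
   exists h rho : R -> R,
     [/\ increasing_null alpha0 h,
         order_function rho &
         forall a : R, parameter_range alpha0 a ->
           (residual_sup g a (h a) <= (rho a)%:E)%E]).
Proof.
split=> [h rho eps [_ _ h_to0] rho_order eps_gt0 sup_le|res_decr].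
  have rho_qual := weak_qualification_of_residual_sup
    _ _ _ _ _ _ halpha0 h_to0 rho_order eps_gt0 sup_le.
  by split=> //; exists rho.
have th_lt := lt_threshold _ _ _ hg; have th_gt0 := threshold_gt0 _ _ _ hg.
have th_to0 := threshold_cvg0 _ _ _ hg.
exists (threshold _ alpha0 g), (threshold _ alpha0 g); split.
- by split=> // [a [a_gt0 _]|a b _ _]; [exact: th_gt0|exact: th_lt].
(* An order function must be monotone on all positive reals, even beyond [alpha0]; [threshold] is
   strictly increasing on the whole line. *)
- split=> // a b _; rewrite le_eqVlt => /predU1P[->//|/th_lt]; exact: ltW.
- move=> a a_range; have [res_gt0 res_mono] := res_decr a a_range.
  exact: residual_sup_threshold.
Qed.
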